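(* For any integer $n \ge 2$, $$\sum_{\pi \in \mathcal{F}(n; 213)} q^{\mathtt{runs}(\pi)} = \sum_{r \geq 1}q^{r}\binom{n-1}{2r - 2}.$$ Consequently, $|\mathcal{F}(n; 213)| = 2^{n-2}$ for all $n\ge 2$, with $|\mathcal{F}(1; 213)| = 1$.
   Context: For a positive integer $n$, $[n]=\{1,\dots,n\}$, and a permutation $\sigma$ of $[n]$ is written as the word $\sigma(1)\sigma(2)\cdots\sigma(n)$. A run of $\sigma$ is a maximal block of consecutive positions on which $\sigma$ is increasing, so $\sigma$ is uniquely the concatenation of its runs; the starting point of a run is its first entry. $\mathtt{runs}(\sigma)$ is the number of runs of $\sigma$. A flattened partition over $[n]$ is a permutation of $[n]$ whose runs, read from left to right, have increasing starting points. A permutation contains a pattern $\tau$ if it has a (not necessarily contiguous) subsequence order-isomorphic to $\tau$; otherwise it is $\tau$-avoiding. $\mathcal{F}(n;\tau)$ is the set of $\tau$-avoiding flattened partitions over $[n]$. Here $q$ is an indeterminate. *)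

(* Defs.v *)
From mathcomp Require Import all_boot all_fingroup.

Set Implicit Arguments.
Unset Strict Implicit.
Unset Printing Implicit Defensive.

(* Positions and entries are numbered from 0: a permutation of [n] is an
   s : 'S_n, its word being (s 0).+1 (s 1).+1 ... (s (n - 1)).+1. Runs,
   flattenedness and pattern containment only compare positions and entries,
   so the shift by one does not affect them. *)
Definition word n (s : 'S_n) : seq nat := [seq (s i).+1 | i <- enum 'I_n].

Definition increasing_block n (s : 'S_n) (B : {set 'I_n}) : bool :=
  [&& B != set0,
      [forall i in B, forall k in B, forall j : 'I_n,
         (i <= j <= k) ==> (j \in B)]
    & [forall i in B, forall j in B, (i < j) ==> (s i < s j)]].

(* A run is represented by the set of the positions it occupies. *)
Definition runs n (s : 'S_n) : {set {set 'I_n}} :=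
  [set B | maxset (increasing_block s) B].

Definition first_position n (B : {set 'I_n}) (i : 'I_n) : bool :=
  (i \in B) && [forall j in B, i <= j].

Definition flattened n (s : 'S_n) : bool :=
  [forall A in runs s, forall B in runs s,
    [forall i : 'I_n, forall j : 'I_n,
      [&& first_position A i, first_position B j & i < j] ==> (s i < s j)]].

Definition contains k n (t : 'S_k) (s : 'S_n) : bool :=
  [exists f : {ffun 'I_k -> 'I_n},
    [forall i : 'I_k, forall j : 'I_k, (i < j) ==> (f i < f j)] &&
    [forall i : 'I_k, forall j : 'I_k, (s (f i) < s (f j)) == (t i < t j)]].

Definition avoiding_flattened n k (t : 'S_k) : {set 'S_n} :=
  [set s : 'S_n | flattened s && ~~ contains t s].

Definition p213 : 'S_3 := tperm (@Ordinal 3 0 isT) (@Ordinal 3 1 isT).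

Lemma word_p213 : word p213 = [:: 2; 1; 3].
Proof.
rewrite /word enum_ordSl enum_ordSl enum_ordSl /=.
rewrite (_ : enum 'I_0 = [::]) /=; last by apply: size0nil; rewrite size_enum_ord.
by rewrite /p213 !permE.
Qed.

(* Main.v *)
Require Import Defs.
From mathcomp Require Import all_boot all_fingroup all_algebra.
From mathcomp Require Import classical_sets fsbigop.
From mathcomp Require Import fintype finset zify.

Set Implicit Arguments.
Unset Strict Implicit.
Unset Printing Implicit Defensive.

(** Call a position high when its entry exceeds the last entry of the word, and
    low otherwise. In a 213-avoiding flattened partition every run consists of
    low positions followed by high positions, the low entries increase along the
    whole word, and the high entries of a run exceed all entries of later runs.
    Indeed, avoiding 213 says that everything from the bottom of an inversion
    onwards stays below its top ([avoiding_descent_tail]), while flattenedness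
    makes each starting point smaller than everything after it
    ([run_start_min]); in particular starting points are low. So positions i < j
    are inverted exactly when i is high and some low position k satisfies
    i < k <= j ([avoiding_flattened_inversion]).

    The set of high positions therefore determines the permutation. It contains
    neither the first position, which carries the least entry, nor the last one.
    Conversely every set H of inner positions is the set of high positions of
    such a partition, because the prescribed inversions come from comparing
    numerical keys ([key_inverted], [inversions_avoiding_flattened]). With n
    positions this gives 2 ^ (n - 2) partitions as soon as n >= 2.

    For the generating function, record H by the set of gaps between
    consecutive positions, out of n - 1, where membership in H changes. Since H
    misses both ends, the number of changes is even, and every even set of gaps
    occurs ([changes_image]). A new run starts exactly where H is left, that is
    at every second change, so r runs correspond to 2r - 2 changes
    ([card_runs_changes]) and there are 'C(n - 1, 2r - 2) choices. *)

(** * Runs and their starting positions *)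

(** The first position qualifies vacuously. *)
Definition run_start n (s : 'S_n) (i : 'I_n) : bool :=
  [forall j : 'I_n, (j.+1 == i :> nat) ==> (s i < s j)].

Definition run_from n (s : 'S_n) (i : 'I_n) : {set 'I_n} :=
  [set j : 'I_n | (i <= j) &&
     [forall k : 'I_n, (i < k <= j) ==> ~~ run_start s k]].

Lemma perm_lt_total n (s : 'S_n) (i j : 'I_n) :
  i != j -> (s i < s j) = ~~ (s j < s i).
Proof.
move=> ij; rewrite -leqNgt ltn_neqAle; case: eqP => //= /ord_inj /perm_inj e.
by rewrite e eqxx in ij.
Qed.

(** If no run started in between, the entries would increase from i to j. *)
Lemma inversion_start n (s : 'S_n) (i j : 'I_n) :
  i < j -> s j < s i -> exists2 k : 'I_n, i < k <= j & run_start s k.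
Proof.
have [v jv] : exists v, j = v :> nat by exists j.
elim: v j jv => [|v IHv] j jv ij ji; first by lia.
have vn : v < n by have := ltn_ord j; lia.
case: (boolP (run_start s j)) => [js|]; first by exists j => //; lia.
case/forallPn => k; rewrite negb_imply -leqNgt => /andP[/eqP kj kjs].
have ik : i < k.
  suff : i != k :> nat by lia.
  by apply/eqP => /ord_inj e; move: kjs; rewrite -e; lia.
have kv : k = v :> nat by lia.
have [l lk ls] := IHv k kv ik (leq_ltn_trans kjs ji).
by exists l => //; lia.
Qed.

(** Convexity puts both a position strictly after i and its predecessor in the
    block, where the entries increase. *)
Lemma block_no_start n (s : 'S_n) (B : {set 'I_n}) (i j k : 'I_n) :
  increasing_block s B -> i \in B -> k \in B -> i < j <= k -> ~~ run_start s j.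
Proof.
case/and3P => _ /forall_inP cvx /forall_inP inc iB kB ijk.
have dn : j.-1 < n by have := ltn_ord j; lia.
pose d := Ordinal dn.
have jB : j \in B.
  by have /forall_inP/(_ k kB)/forallP/(_ j)/implyP := cvx i iB; apply; lia.
have dB : d \in B.
  have /forall_inP/(_ k kB)/forallP/(_ d)/implyP := cvx i iB; apply => /=; lia.
have /forall_inP/(_ j jB)/implyP/= dj := inc d dB.
apply/forallPn; exists d; rewrite negb_imply -leqNgt ltnW ?dj ?andbT //=; lia.
Qed.

Lemma run_from_block n (s : 'S_n) (i : 'I_n) : increasing_block s (run_from s i).
Proof.
apply/and3P; split.
- apply/set0Pn; exists i; rewrite inE leqnn; apply/forallP => k; apply/implyP; lia.
- apply/forall_inP => a; rewrite inE => /andP[ia _].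
  apply/forall_inP => c; rewrite inE => /andP[ic /forallP noc].
  apply/forallP => b; apply/implyP => /andP[ab bc]; rewrite inE (leq_trans ia ab).
  apply/forallP => k; apply/implyP => kb; apply: (implyP (noc k)); lia.
- apply/forall_inP => a; rewrite inE => /andP[ia _].
  apply/forall_inP => b; rewrite inE => /andP[ib /forallP nob].
  apply/implyP => ab; rewrite perm_lt_total; last by apply/eqP=> e; move: ab; rewrite e ltnn.
  apply/negP => /(inversion_start ab) [k kab ks].
  by have /implyP := nob k; rewrite ks /= => /(_ _)/notF; apply; lia.
Qed.

(** A block containing i cannot extend to the left of i, since i starts a run,
    nor to the right past the next starting position. *)
Lemma run_from_run n (s : 'S_n) (i : 'I_n) :
  run_start s i -> run_from s i \in runs s.
Proof.
move=> si; rewrite inE; apply/maxsetP; split; first exact: run_from_block.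
move=> B blB sub; apply/eqP; rewrite eqEsubset sub andbT; apply/subsetP => j jB.
have iB : i \in B.
  by apply: (subsetP sub); rewrite inE leqnn; apply/forallP => k; apply/implyP; lia.
rewrite inE; case: leqP => [ij|ji] /=.
  by apply/forallP => k; apply/implyP; apply: block_no_start blB iB jB.
by have := block_no_start blB jB iB (j := i); rewrite ji leqnn si => /(_ isT).
Qed.

Lemma last_start_before n (s : 'S_n) (i : 'I_n) :
  exists2 k : 'I_n, run_start s k & i \in run_from s k.
Proof.
have n0 : 0 < n by have := ltn_ord i; lia.
pose z := Ordinal n0.
have Pz : run_start s z && (z <= i).
  by rewrite andbT; apply/forallP => j; apply/implyP.
case: (@arg_maxnP _ z (fun k => run_start s k && (k <= i)) val Pz) => k /andP[ks ki] kmax.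
exists k => //; rewrite inE ki; apply/forallP => l; apply/implyP => /andP[kl li].
by apply/negP => ls; have := kmax l; rewrite ls li => /(_ isT) /=; lia.
Qed.

(** A run lies in [run_from s i] for the last starting position i before any of
    its elements, and equals it by maximality. *)
Lemma run_is_run_from n (s : 'S_n) (B : {set 'I_n}) :
  B \in runs s -> exists2 i : 'I_n, run_start s i & B = run_from s i.
Proof.
rewrite inE => /maxsetP[blB maxB].
have /and3P[/set0Pn[a aB] _ _] := blB.
have [i si] := last_start_before s a; rewrite inE => /andP[ia /forallP noa].
exists i => //; symmetry; apply: maxB; first exact: run_from_block.
apply/subsetP => b bB; rewrite inE.
case: leqP => [ib|bi] /=.
  apply/forallP => k; apply/implyP => /andP[ik kb].
  have [ka|ak] := leqP k a; first by apply: (implyP (noa k)); rewrite ik.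
  by apply: (block_no_start blB aB bB); rewrite ak.
by have := block_no_start blB bB aB (j := i); rewrite bi ia si => /(_ isT).
Qed.

Lemma first_position_run_from n (s : 'S_n) (i j : 'I_n) :
  first_position (run_from s i) j = (i == j).
Proof.
have iR : i \in run_from s i.
  by rewrite inE leqnn; apply/forallP => k; apply/implyP; lia.
apply/andP/eqP => [[jR /forall_inP/(_ i iR) ji]|<-].
  by apply/ord_inj; move: jR; rewrite inE => /andP[/=]; lia.
by split=> //; apply/forall_inP => k; rewrite inE => /andP[].
Qed.

(** Each run is determined by its first position. *)
Lemma card_runs n (s : 'S_n) : #|runs s| = #|[set i | run_start s i]|.
Proof.
rewrite -(@card_in_imset _ _ (run_from s)).
  apply: eq_card => B; apply/idP/imsetP => [/run_is_run_from[i si ->]|[i]].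
    by exists i; rewrite ?inE.
  by rewrite inE => si ->; apply: run_from_run.
move=> i j _ _ e; have := first_position_run_from s i i.
by rewrite e first_position_run_from eqxx => /eqP.
Qed.

(** Flattenedness without sets of runs: it only concerns the positions where
    runs start. *)
Lemma flattenedP n (s : 'S_n) :
  reflect (forall i j : 'I_n, run_start s i -> run_start s j -> i < j -> s i < s j)
          (flattened s).
Proof.
apply: (iffP forall_inP) => [fl i j si sj ij|fl A /run_is_run_from[i si ->]].
  have /forall_inP/(_ _ (run_from_run sj))/forallP/(_ i)/forallP/(_ j)/implyP :=
    fl _ (run_from_run si).
  by apply; rewrite !first_position_run_from !eqxx.
apply/forall_inP => B /run_is_run_from[j sj ->].
apply/forallP => i'; apply/forallP => j'; rewrite !first_position_run_from.
by apply/implyP => /and3P[/eqP<- /eqP<-]; apply: fl.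
Qed.

(** The entry at j is at least the entry starting its own run, which is in turn
    at least the entry starting any earlier run. *)
Lemma run_start_min n (s : 'S_n) (i j : 'I_n) :
  flattened s -> run_start s i -> i <= j -> s i <= s j.
Proof.
move=> /flattenedP fl si ij; have [k sk] := last_start_before s j.
rewrite inE => /andP[kj /forallP nok].
have kj' : s k <= s j.
  rewrite leqNgt; apply/negP => jk; have [|l lk sl] := inversion_start (i := k) (j := j) _ jk.
    by rewrite ltn_neqAle kj andbT; apply/eqP => /ord_inj e; rewrite e ltnn in jk.
  by have := implyP (nok l) lk; rewrite sl.
apply: leq_trans kj'; have [ik|ki] := ltnP i k; first by apply/ltnW/fl.
rewrite leq_eqVlt; case: (ltngtP i k) => [|ki'|/ord_inj->]; rewrite ?eqxx //; first by lia.
by have := implyP (nok i); rewrite ki' ij si => /(_ isT).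
Qed.

Lemma contains213P n (s : 'S_n) :
  reflect (exists i j k : 'I_n, [/\ i < j, j < k, s j < s i & s i < s k])
          (contains p213 s).
Proof.
pose o0 := @Ordinal 3 0 isT; pose o1 := @Ordinal 3 1 isT; pose o2 := @Ordinal 3 2 isT.
have p0 : p213 o0 = o1 by rewrite /p213 permE.
have p1 : p213 o1 = o0 by rewrite /p213 permE.
have p2 : p213 o2 = o2 by rewrite /p213 permE.
have all3 (P : pred 'I_3) : [forall x, P x] = [&& P o0, P o1 & P o2].
  apply/forallP/and3P => [h|[h0 h1 h2] [[|[|[|x]]] lx]] //.
  - by rewrite (_ : Ordinal lx = o0) //; apply: ord_inj.
  - by rewrite (_ : Ordinal lx = o1) //; apply: ord_inj.
  - by rewrite (_ : Ordinal lx = o2) //; apply: ord_inj.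
apply: (iffP existsP) => [[f]|[i [j [k [ij jk ji ik]]]]].
  rewrite !all3 /= p0 p1 p2 /=; move=> H; exists (f o0), (f o1), (f o2).
  by move: H; rewrite !ltnn /=; split; lia.
exists [ffun x : 'I_3 => if x == o0 then i else if x == o1 then j else k].
rewrite !all3 /= p0 p1 p2 !ffunE /= !ltnn.
by apply/andP; split; lia.
Qed.

(** * High positions *)

Definition high m (s : 'S_m.+1) : {set 'I_m.+1} := [set i | s ord_max < s i].

(** The inversions of the partition whose high positions form H: high entries
    are passed by everything that follows the next low position. *)
Definition inverted m (H : {set 'I_m}) (i j : 'I_m) : bool :=
  (i \in H) && [exists k : 'I_m, (i < k <= j) && (k \notin H)].

Definition inner m : {set 'I_m.+1} := ~: [set ord0; ord_max].

Lemma innerP m (H : {set 'I_m.+1}) :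
  reflect (ord0 \notin H /\ ord_max \notin H) (H \subset inner m).
Proof.
rewrite /inner subsetC subUset !sub1set !in_setC.
exact: andP.
Qed.

Lemma run_start0 m (s : 'S_m.+1) : run_start s ord0.
Proof. by apply/forallP => j; apply/implyP. Qed.

(** A later entry above s i would complete i and j to a pattern 213. *)
Lemma avoiding_descent_tail n (s : 'S_n) (i j k : 'I_n) :
  ~~ contains p213 s -> i < j -> s j < s i -> j <= k -> s k < s i.
Proof.
move=> av ij ji; rewrite leq_eqVlt => /orP[/eqP/ord_inj <-//|jk].
rewrite perm_lt_total; last by apply/eqP => e; move: jk; rewrite e; lia.
by apply/negP => ik; case/contains213P: av; exists i, j, k.
Qed.

(** If i < j are inverted, a run starts between them, and its start is low by
    [run_start_min]; i is high because the last entry lies below s i by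
    [avoiding_descent_tail]. If i is high and k is low, then i and k are
    inverted, and [avoiding_descent_tail] extends this to all j >= k. *)
Lemma avoiding_flattened_inversion m (s : 'S_m.+1) (i j : 'I_m.+1) :
  s \in avoiding_flattened m.+1 p213 -> i < j ->
  (s j < s i) = inverted (high s) i j.
Proof.
rewrite inE => /andP[fl av] ij; apply/idP/andP => [ji|[]].
  have [k /andP[ik kj] sk] := inversion_start ij ji.
  split; first by rewrite inE (avoiding_descent_tail av ij ji) ?leq_ord.
  apply/existsP; exists k; rewrite ik kj inE -leqNgt.
  by apply: run_start_min; rewrite ?leq_ord.
rewrite inE => iH /existsP[k /andP[/andP[ik kj]]]; rewrite inE -leqNgt => kL.
exact: avoiding_descent_tail av ik (leq_ltn_trans kL iH) kj.
Qed.

Lemma high_inner m (s : 'S_m.+1) :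
  flattened s -> high s \subset inner m.
Proof.
move=> fl; apply/innerP; rewrite !inE ltnn -leqNgt; split=> //.
by apply: run_start_min; rewrite ?run_start0.
Qed.

Section FromInversions.

Variables (m : nat) (s : 'S_m.+1) (H : {set 'I_m.+1}).
Hypothesis sH : forall i j : 'I_m.+1, i < j -> (s j < s i) = inverted H i j.

(** Consecutive positions d and d + 1 are inverted exactly when d is in H and
    d + 1 is not. *)
Lemma inversions_start (d : 'I_m) :
  run_start s (lift ord0 d) =
  (widen_ord (leqnSn m) d \in H) && (lift ord0 d \notin H).
Proof.
have dd : widen_ord (leqnSn m) d < lift ord0 d by rewrite /= /bump; lia.
have -> : run_start s (lift ord0 d) = (s (lift ord0 d) < s (widen_ord (leqnSn m) d)).
  apply/forallP/idP => [/(_ (widen_ord (leqnSn m) d))/implyP|h j].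
    by apply; rewrite /= /bump; lia.
  apply/implyP => /eqP e.
  by rewrite (_ : j = widen_ord (leqnSn m) d) //; apply: ord_inj;
    move: e; rewrite /= /bump; lia.
rewrite sH // /inverted; congr (_ && _); apply/existsP/idP => [[k /andP[dk]]|h].
  by rewrite (_ : k = lift ord0 d) //; apply: ord_inj; move: dk; rewrite /= /bump; lia.
by exists (lift ord0 d); rewrite h dd /=.
Qed.

Lemma card_runs_inversions :
  #|runs s| = (\sum_(d < m)
    ((widen_ord (leqnSn m) d \in H) && (lift ord0 d \notin H))).+1.
Proof.
rewrite card_runs -sum1_card big_mkcond big_ord_recl inE run_start0 -[RHS]add1n; congr (_ + _).
by apply: eq_bigr => d _; rewrite inE inversions_start; case: ifP.
Qed.

Hypothesis Hinner : H \subset inner m.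

Lemma inversions_high : high s = H.
Proof.
have [_ nmax] := innerP _ Hinner.
apply/setP => i; rewrite inE.
case: (ltngtP i (ord_max : 'I_m.+1)) => [im|/=|/ord_inj->]; first 1 last.
- by have := ltn_ord i; lia.
- by rewrite ltnn (negPf nmax).
rewrite sH // /inverted; case: (i \in H) => //=.
by apply/existsP; exists ord_max; rewrite im nmax leqnn.
Qed.

(** Starting positions avoid H, and positions outside H are never the top of an
    inversion: hence flattenedness. For a pattern 213 at i < j < k, the
    position outside H that makes i and j inverted also lies between i and k,
    and makes them inverted too. *)
Lemma inversions_avoiding_flattened : s \in avoiding_flattened m.+1 p213.
Proof.
have [n0 _] := innerP _ Hinner.
have start_low (i : 'I_m.+1) : run_start s i -> i \notin H.
  case: (unliftP ord0 i) => [d|] -> //.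
  by rewrite inversions_start => /andP[].
rewrite inE; apply/andP; split.
  apply/flattenedP => i j si sj ij.
  rewrite perm_lt_total; last by apply/eqP => e; move: ij; rewrite e; lia.
  by rewrite sH // /inverted (negPf (start_low _ si)).
apply/contains213P => -[i [j [k [ij jk]]]].
rewrite sH // => /andP[iH /existsP[l /andP[/andP[il lj] lL]]].
have ik := ltn_trans ij jk.
rewrite perm_lt_total; last by apply/eqP => e; move: ik; rewrite e; lia.
rewrite sH // /inverted iH => /existsP; apply; exists l.
by rewrite il lL (leq_trans lj) // ltnW.
Qed.

End FromInversions.

(** * Permutations with prescribed inversions *)

(** The rank of f i among the values of f is the entry at i. *)
Lemma perm_of_key n (f : 'I_n -> nat) :
  injective f -> {s : 'S_n | forall i j, (s i < s j) = (f i < f j)}.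
Proof.
move=> injf; pose below i := [set k | f k < f i].
have below_lt i : #|below i| < n.
  rewrite -[X in _ < X]card_ord -cardsT; apply: proper_card; rewrite properEneq subsetT andbT.
  by apply/eqP => /setP/(_ i); rewrite !inE ltnn.
have rank_lt i j : f i < f j -> #|below i| < #|below j|.
  move=> ij; apply: proper_card; apply/properP; split.
    by apply/subsetP => k; rewrite !inE => /ltn_trans; apply.
  by exists i; rewrite !inE ?ltnn.
have rank_mono i j : (#|below i| < #|below j|) = (f i < f j).
  apply/idP/idP => [|/rank_lt//]; case: (ltngtP (f i) (f j)) => //.
    by move/rank_lt; lia.
  by move/injf=> ->; rewrite ltnn.
have inj_rank : injective (fun i => Ordinal (below_lt i)).
  move=> i j [e]; apply: injf.
  by case: (ltngtP (f i) (f j)) => // /rank_lt; rewrite e ltnn.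
by exists (perm inj_rank) => i j; rewrite !permE /= rank_mono.
Qed.

(** An entry of a permutation equals the number of smaller entries, so the
    inversions determine the permutation. *)
Lemma perm_order_inj n (s t : 'S_n) :
  (forall i j : 'I_n, i < j -> (s j < s i) = (t j < t i)) -> s = t.
Proof.
move=> st; have st' (i j : 'I_n) : (s j < s i) = (t j < t i).
  case: (ltngtP i j) => [ij|ji|/ord_inj->]; [exact: st| |by rewrite !ltnn].
  have ij : j != i by apply/eqP => e; move: ji; rewrite e ltnn.
  by rewrite !(perm_lt_total _ ij) st.
have rank (u : 'S_n) (i : 'I_n) : #|[set j | u j < u i]| = u i.
  rewrite -(card_imset _ (@perm_inj _ u)).
  have -> : [set u x | x in [set j | u j < u i]] = [set x : 'I_n | x < u i].
    apply/setP => x; rewrite inE; apply/imsetP/idP => [[y]|xi]; first by rewrite inE => ? ->.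
    by exists ((u^-1)%g x); rewrite ?inE permKV.
  rewrite -sum1dep_card -(big_ord_widen_cond n xpredT (fun=> 1)); last exact/ltnW.
  by rewrite sum1_card card_ord.
apply/permP => i; apply: ord_inj; rewrite -(rank s i) -(rank t i).
by apply: eq_card => j; rewrite !inE st'.
Qed.

(** Positions outside H keep their index, which is below n. Those in H are
    ranked above them, first by the number of later positions outside H, so that
    earlier maximal blocks of H get larger keys, and then by index inside a
    block. *)
Definition key n (H : {set 'I_n}) (i : 'I_n) : nat :=
  if i \in H then #|[set k : 'I_n | (i <= k) && (k \notin H)]|.+1 * n + i else i.

(** Only i in H is delicate. If j is outside H, its key is below n. If j is in H,
    the count in [key] drops from i to j exactly when some position outside H
    lies between them, and a drop by one outweighs the difference of the
    indices. *)
Lemma key_inverted n (H : {set 'I_n}) (i j : 'I_n) :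
  i < j -> (key H j < key H i) = inverted H i j.
Proof.
move=> ij; rewrite /key /inverted; have := ltn_ord i; have := ltn_ord j.
case: (boolP (i \in H)) => iH jn i_n /=; last by case: ifP => _; nia.
set c := fun i : 'I_n => #|[set k : 'I_n | (i <= k) && (k \notin H)]|.
rewrite -/(c i) -/(c j).
have cji : c j <= c i.
  by apply/subset_leq_card/subsetP => k; rewrite !inE; case: (k \in H); lia.
case: (boolP (j \in H)) => jH.
  case: existsP => [[k /andP[/andP[ik kj] kL]]|no].
    suff : c j < c i by nia.
    apply: proper_card; apply/properP; split.
      by apply/subsetP => l; rewrite !inE; case: (l \in H); lia.
    exists k; rewrite !inE kL; first by lia.
    suff : k != j :> nat by lia.
    by apply/eqP => /ord_inj e; move: kL; rewrite e jH.
  suff -> : c i = c j by lia.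
  apply: eq_card => k; rewrite !inE; case: (boolP (k \in H)) => kH; rewrite ?andbF ?andbT //.
  apply/idP/idP => ik; last by lia.
  rewrite leqNgt; apply/negP => kj; apply: no; exists k.
  rewrite kH (ltnW kj) !andbT ltn_neqAle ik andbT.
  by apply/eqP => /ord_inj e; move: kH; rewrite -e iH.
have -> : [exists k : 'I_n, (i < k <= j) && (k \notin H)].
  by apply/existsP; exists j; rewrite ij jH leqnn.
by nia.
Qed.

Lemma key_inj n (H : {set 'I_n}) : injective (key H).
Proof.
move=> i j e; apply: ord_inj; move: e; rewrite /key.
have := ltn_ord i; have := ltn_ord j.
case: ifP => _; case: ifP => _; try nia.
move=> jn i_n /(congr1 (modn^~ n)).
by rewrite /= !modnMDl !modn_small.
Qed.

(** * Partitions and sets of inner positions *)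

Lemma high_inj m : {in avoiding_flattened m.+1 p213 &, injective (@high m)}.
Proof.
move=> s t Fs Ft e; apply: perm_order_inj => i j ij.
by rewrite !avoiding_flattened_inversion // e.
Qed.

Lemma high_image m :
  [set high s | s in avoiding_flattened m.+1 p213] = powerset (inner m).
Proof.
apply/setP => H; rewrite powersetE; apply/imsetP/idP => [[s]|Hin].
  by rewrite inE => /andP[fl _] ->; apply: high_inner.
have [s sk] := perm_of_key (@key_inj _ H).
have sH (i j : 'I_m.+1) : i < j -> (s j < s i) = inverted H i j.
  by move=> ij; rewrite sk key_inverted.
by exists s; rewrite ?(inversions_high sH) //; apply: inversions_avoiding_flattened Hin.
Qed.

Lemma card_avoiding_flattened m :
  #|avoiding_flattened m.+1 p213| = 2 ^ m.-1.
Proof.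
rewrite -(card_in_imset (@high_inj m)) high_image card_powerset; congr (2 ^ _).
have := cardsC [set ord0; ord_max : 'I_m.+1]; rewrite -/(inner m) card_ord cards2.
case: (eqVneq ord0 (ord_max : 'I_m.+1)) => [/(congr1 (@nat_of_ord _))/= <-|].
  by rewrite add1n => -[->].
by case: m => [|m] ne; rewrite add2n => -[] // ->.
Qed.

(** * Changes of membership *)

(** Gap d separates the positions d and d + 1. *)
Definition changes m (H : {set 'I_m.+1}) : {set 'I_m} :=
  [set d | (widen_ord (leqnSn m) d \in H) != (lift ord0 d \in H)].

(** Switching on and switching off alternate, starting with on; the term h m
    counts a final switching on that is still unmatched. *)
Lemma sum_changes (h : nat -> bool) (m : nat) :
  h 0 = false ->
  \sum_(d < m) (h d != h d.+1 : nat) = (\sum_(d < m) (h d && ~~ h d.+1)).*2 + h m.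
Proof.
move=> h0; elim: m => [|m IHm]; first by rewrite !big_ord0 h0.
by rewrite !big_ord_recr /= IHm doubleD; case: (h m); case: (h m.+1) => /=; lia.
Qed.

Lemma mem_widen_inord m (H : {set 'I_m.+1}) (d : 'I_m) :
  (widen_ord (leqnSn m) d \in H) = (inord d \in H).
Proof. by congr (_ \in H); apply: ord_inj; rewrite inordK //= ltnS ltnW. Qed.

Lemma mem_lift_inord m (H : {set 'I_m.+1}) (d : 'I_m) :
  (lift ord0 d \in H) = (inord d.+1 \in H).
Proof. by congr (_ \in H); apply: ord_inj; rewrite inordK //= ltnS. Qed.

Lemma card_changes m (H : {set 'I_m.+1}) :
  H \subset inner m ->
  #|changes H| = (\sum_(d < m)
    ((widen_ord (leqnSn m) d \in H) && (lift ord0 d \notin H))).*2.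
Proof.
case/innerP => n0 nmax.
pose h k := @inord m k \in H.
have h0 : h 0 = false.
  by apply/negbTE; rewrite /h (_ : inord 0 = ord0) //; apply: ord_inj; rewrite inordK.
have hm : h m = false.
  by apply/negbTE; rewrite /h (_ : inord m = ord_max) //; apply: ord_inj; rewrite inordK.
have := @sum_changes h m h0; rewrite hm addn0 => E.
rewrite -sum1_card big_mkcond /=.
transitivity (\sum_(d < m) (h d != h d.+1 : nat)).
  by apply: eq_bigr => d _; rewrite inE mem_widen_inord mem_lift_inord; case: ifP.
rewrite E; congr _.*2; apply: eq_bigr => d _.
by rewrite mem_widen_inord mem_lift_inord.
Qed.

(** The first position is outside, and the changes propagate this information
    along the word. *)
Lemma changes_inj m : {in powerset (inner m) &, injective (@changes m)}.
Proof.
move=> H K; rewrite !powersetE => /innerP[H0 _] /innerP[K0 _] e.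
have step (k : nat) : k <= m -> (@inord m k \in H) = (@inord m k \in K).
  elim: k => [_|k IHk km].
    have -> : inord 0 = ord0 :> 'I_m.+1 by apply: ord_inj; rewrite inordK.
    by rewrite (negPf H0) (negPf K0).
  have := congr1 (fun D : {set 'I_m} => Ordinal km \in D) e.
  rewrite /= !inE !mem_widen_inord !mem_lift_inord /= (IHk (ltnW km)).
  by do 3!case: (_ \in _).
by apply/setP => i; rewrite -(inord_val i) step // -ltnS.
Qed.

(** The set with changes D consists of the positions preceded by an odd number
    of elements of D; it misses the last position because D has an even number
    of elements. *)
Lemma changes_image m :
  [set changes H | H in powerset (inner m)] = [set D : {set 'I_m} | ~~ odd #|D|].
Proof.
apply/setP => D; rewrite inE; apply/imsetP/idP => [[H]|evenD].
  by rewrite powersetE => /card_changes cH ->; rewrite cH odd_double.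
pose before k := #|[set d in D | d < k]|.
have beforeS (d : 'I_m) : before d.+1 = (d \in D) + before d.
  rewrite /before (cardsD1 d) !inE leqnn andbT; congr (_ + _).
  apply: eq_card => k; rewrite !inE; have := inj_eq (@ord_inj m) k d.
  by case: (k \in D); case: eqP => /=; case: eqP => //; lia.
exists [set i : 'I_m.+1 | odd (before i)].
  rewrite powersetE; apply/innerP; rewrite !inE; split.
    rewrite (_ : before _ = 0) //; apply/eqP; rewrite cards_eq0.
    by apply/eqP/setP => d; rewrite !inE andbF.
  by rewrite (_ : before _ = #|D|) //; apply: eq_card => d; rewrite !inE ltn_ord andbT.
apply/setP => d; rewrite !inE.
have -> : before (lift ord0 d) = before d.+1 by [].
by rewrite beforeS oddD /=; case: (d \in D); case: (odd _).
Qed.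

(** A run other than the first starts where the set of high positions is left,
    which accounts for half of the changes. *)
Lemma card_runs_changes m (s : 'S_m.+1) :
  s \in avoiding_flattened m.+1 p213 -> #|runs s| = #|changes (high s)|./2.+1.
Proof.
move=> Fs; have fl : flattened s by move: Fs; rewrite inE => /andP[].
rewrite (card_changes (high_inner fl)) doubleK; apply: card_runs_inversions => i j.
exact: avoiding_flattened_inversion.
Qed.

(** * Generating function *)

Import GRing.Theory.
Local Open Scope ring_scope.

Lemma sum_even_sets (R : nmodType) (T : finType) (F : nat -> R) :
  \sum_(D in [set D : {set T} | ~~ odd #|D|]) F #|D|./2 =
  \sum_(k < #|T|.+1) F k *+ 'C(#|T|, k.*2).
Proof.
rewrite (partition_big (fun D : {set T} => inord #|D|./2 : 'I_#|T|.+1) xpredT) //=.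
apply: eq_bigr => k _.
have half_lt (D : {set T}) : (#|D|./2 < #|T|.+1)%N.
  rewrite ltnS; apply: leq_trans (max_card (mem D)).
  by rewrite leq_half_double -addnn -addnS leq_addr.
rewrite -card_draws -sumr_const; apply: eq_big => [D|D].
  rewrite !inE -val_eqE /= inordK //.
  by apply/andP/eqP => [[ev /eqP<-]|->]; rewrite ?odd_double ?doubleK ?eqxx // even_halfK.
by case/andP => _ /eqP<-; rewrite inordK.
Qed.

(** Re-index by high positions and then by changes. *)
Lemma runs_generating_function (m : nat) :
  \sum_(s in avoiding_flattened m.+1 p213) ('X^(#|runs s|) : {poly int}) =
  \sum_(k < m.+1) 'X^(k.+1) *+ 'C(m, k.*2).
Proof.
pose F k : {poly int} := 'X^(k.+1).
transitivity (\sum_(s in avoiding_flattened m.+1 p213) F #|changes (high s)|./2).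
  by apply: eq_bigr => s /card_runs_changes ->.
rewrite -(big_imset (fun H : {set 'I_m.+1} => F #|changes H|./2) (@high_inj m)) high_image.
rewrite -(big_imset (fun D : {set 'I_m} => F #|D|./2) (@changes_inj m)) changes_image.
by rewrite sum_even_sets card_ord.
Qed.

Theorem theorem2p3 :
  [/\ (forall n : nat, (2 <= n)%N ->
        (\sum_(s in avoiding_flattened n p213) ('X^(#|runs s|) : {poly int}) =
         \sum_(r \in [set r : nat | (1 <= r)%N]%classic)
           'C(n.-1, 2 * r - 2)%:R *: ('X^r : {poly int}))%R),
      (forall n : nat, (2 <= n)%N ->
        #|avoiding_flattened n p213| = (2 ^ (n - 2))%N)
    & #|avoiding_flattened 1 p213| = 1%N].
Proof.
split; last exact: card_avoiding_flattened.
  case=> // m m1; rewrite runs_generating_function /=.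
  (* 'C(m, 2r - 2) vanishes for r > m + 1. *)
  rewrite (fsbigE (iota 1 m.+1)); first last.
  - move=> r; rewrite mem_iota => r1 nr.
    have {}r1 : (1 <= r)%N := r1.
    by rewrite bin_small ?scale0r //; lia.
  - by move=> r; rewrite /mkset mem_iota => /andP[].
  - exact: iota_uniq.
  rewrite -(addn0 1%N) iotaDl big_map -[iota _ _]/(index_iota 0 m.+1) big_mkord.
  apply: eq_big => k; first by rewrite mem_set.
  move=> _.
  by rewrite scaler_nat add1n; congr (_ *+ 'C(_, _)); lia.
by case=> [|[|m]] // _; rewrite card_avoiding_flattened subn2.
Qed.
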